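(* Let $\mathfrak{H}_1,\mathfrak{H}_2,\mathfrak{K}$ be Hilbert spaces, $\mathfrak{H}=\mathfrak{H}_1\times\mathfrak{H}_2$, and let $R_i\subseteq\mathfrak{H}_i\times\mathfrak{K}$, $i\in\{1,2\}$, be linear relations. For $i\in\{1,2\}$ let $P_i$ be the operator from $\mathfrak{H}$ to $\mathfrak{H}_i$ given by $(h_1,h_2)\mapsto h_i$, and let $\widetilde{P}_i:=P_i^*$ be its adjoint, an operator from $\mathfrak{H}_i$ to $\mathfrak{H}$. Then $$\begin{pmatrix}R_1 & R_2\end{pmatrix}=R_1\widetilde{P}_1^{-1}\,\widehat{+}\,R_2\widetilde{P}_2^{-1}=R_1P_1+R_2P_2.$$
   Context: A linear relation from a Hilbert space $X$ to a Hilbert space $Y$ is a linear subspace $A\subseteq X\times Y$; operators are identified with their graphs, and $X\times Y$ carries the Hilbert-sum inner product. The adjoint is $A^*=\{(y',x')\in Y\times X: \langle x,x'\rangle_X=\langle y,y'\rangle_Y\ \text{for all }(x,y)\in A\}$. The inverse is always taken in the sense of linear relations: $A^{-1}=\{(y,x):(x,y)\in A\}$. The product of $A\subseteq X\times Y$ and $B\subseteq Y\times Z$ is $BA=\{(x,z): (x,y)\in A,\ (y,z)\in B\text{ for some }y\}$. For linear relations $A_1,A_2\subseteq X\times Y$, the operatorwise sum is $A_1+A_2=\{(h,k_1+k_2): (h,k_1)\in A_1,\ (h,k_2)\in A_2\}$ and the componentwise sum is $A_1\,\widehat{+}\,A_2=\{(h_1+h_2,k_1+k_2): (h_1,k_1)\in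 A_1,\ (h_2,k_2)\in A_2\}$. Row: $\begin{pmatrix}R_1 & R_2\end{pmatrix}:=\{((h_1,h_2),k_1+k_2): (h_1,k_1)\in R_1,\ (h_2,k_2)\in R_2\}\subseteq\mathfrak{H}\times\mathfrak{K}$. *)

(* Defs.v *)
From HB Require Import structures.
From mathcomp Require Import all_boot all_order all_algebra.
From mathcomp Require Import sesquilinear complex.
From mathcomp Require Import boolp classical_sets reals.
From mathcomp Require Import topology normedtype.
From mathcomp Require Import ring.

Set Implicit Arguments.
Unset Strict Implicit.
Unset Printing Implicit Defensive.

Import Order.TTheory GRing.Theory Num.Theory.
Import numFieldNormedType.Exports.

Local Open Scope classical_set_scope.
Local Open Scope ring_scope.

(** Hilbert spaces are over the real or over the complex numbers, uniformly:
    the field is [scalars R k]. *)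
Variant scalar_kind := RealScalars | ComplexScalars.

Definition scalars (R : realType) (k : scalar_kind) : numFieldType :=
  match k with RealScalars => R | ComplexScalars => R[i] end.

Definition scalar_conj (R : realType) (k : scalar_kind) :
    scalars R k -> scalars R k :=
  match k return scalars R k -> scalars R k with
  | RealScalars => idfun
  | ComplexScalars => @Num.conj R[i]
  end.
Arguments scalar_conj : clear implicits.

Definition scalar_sqrt (R : realType) (k : scalar_kind) :
    scalars R k -> scalars R k :=
  match k return scalars R k -> scalars R k with
  | RealScalars => @Num.sqrt R
  | ComplexScalars => fun x : R[i] => sqrtC x
  end.

Section ScalarTheory.
Context {R : realType} {k : scalar_kind}.
Implicit Types x y : scalars R k.

Lemma scalar_sqrt_ge0 x : 0 <= x -> 0 <= scalar_sqrt x.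
Proof. by case: k x => x /=; [rewrite sqrtr_ge0|rewrite sqrtC_ge0]. Qed.

Lemma sqr_scalar_sqrt x : 0 <= x -> scalar_sqrt x ^+ 2 = x.
Proof. by case: k x => x /= x0; [rewrite sqr_sqrtr|rewrite sqrtCK]. Qed.

Lemma scalar_conjD x y :
  scalar_conj R k (x + y) = scalar_conj R k x + scalar_conj R k y.
Proof. by case: k x y => x y //=; rewrite rmorphD. Qed.

End ScalarTheory.

(** A Hilbert space is a complete normed space whose norm comes from an inner
    product; [inner] is linear in its first argument. *)
HB.mixin Record CompleteNormedModule_isHilbert (R : realType) (k : scalar_kind) V
    & CompleteNormedModule (scalars R k) V := {
  inner : {dot V for scalar_conj R k};
  sqr_norm_inner : forall x : V, `|x| ^+ 2 = inner x x
}.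

#[short(type="hilbertType")]
HB.structure Definition Hilbert (R : realType) (k : scalar_kind) :=
  {V of CompleteNormedModule (scalars R k) V
      & CompleteNormedModule_isHilbert R k V}.

(** The Hilbert sum. It is an alias of [U * V] because the library equips
    [U * V] with the max norm. *)
Definition hsum (U V : Type) : Type := (U * V)%type.

Section HilbertSum.
Context {R : realType} {k : scalar_kind} {U V : hilbertType R k}.
Local Notation K := (scalars R k).
Local Notation W := (hsum U V).

HB.instance Definition _ := GRing.Lmodule.copy W (U * V)%type.

Let hnorm (x : W) : K := scalar_sqrt (`|x.1| ^+ 2 + `|x.2| ^+ 2).

Let hnorm2_ge0 (x : W) : 0 <= `|x.1| ^+ 2 + `|x.2| ^+ 2.
Proof. by rewrite addr_ge0 ?exprn_ge0. Qed.

Let hnorm_ge0 x : 0 <= hnorm x.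
Proof. exact/scalar_sqrt_ge0/hnorm2_ge0. Qed.

Let sqr_hnorm x : hnorm x ^+ 2 = `|x.1| ^+ 2 + `|x.2| ^+ 2.
Proof. exact/sqr_scalar_sqrt/hnorm2_ge0. Qed.

Let cauchy_schwarz2 (a b c d : K) : 0 <= a -> 0 <= b -> 0 <= c -> 0 <= d ->
  (a * c + b * d) ^+ 2 <= (a ^+ 2 + b ^+ 2) * (c ^+ 2 + d ^+ 2).
Proof.
move=> a0 b0 c0 d0; rewrite -subr_ge0.
have -> : (a ^+ 2 + b ^+ 2) * (c ^+ 2 + d ^+ 2) - (a * c + b * d) ^+ 2 =
  (a * d - b * c) ^+ 2 by ring.
by rewrite real_exprn_even_ge0// realB// ger0_real// mulr_ge0.
Qed.

Let hnormD x y : hnorm (x + y) <= hnorm x + hnorm y.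
Proof.
rewrite -(@ler_pXn2r _ 2)// ?nnegrE ?addr_ge0// sqr_hnorm.
have /le_trans -> // : `|(x + y).1| ^+ 2 + `|(x + y).2| ^+ 2 <=
   (`|x.1| + `|y.1|) ^+ 2 + (`|x.2| + `|y.2|) ^+ 2.
  by rewrite lerD// ler_pXn2r// ?nnegrE ?addr_ge0// ler_normD.
have -> : (`|x.1| + `|y.1|) ^+ 2 + (`|x.2| + `|y.2|) ^+ 2 =
  hnorm x ^+ 2 + hnorm y ^+ 2 + (`|x.1| * `|y.1| + `|x.2| * `|y.2|) *+ 2.
  by rewrite !sqr_hnorm; ring.
have -> : (hnorm x + hnorm y) ^+ 2 =
  hnorm x ^+ 2 + hnorm y ^+ 2 + (hnorm x * hnorm y) *+ 2 by ring.
rewrite lerD2l lerMn2r/= -(@ler_pXn2r _ 2)// ?nnegrE ?addr_ge0 ?mulr_ge0//.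
by rewrite exprMn !sqr_hnorm cauchy_schwarz2.
Qed.

Let hnormZ (l : K) x : hnorm (l *: x) = `|l| * hnorm x.
Proof.
apply/eqP; rewrite -(@eqrXn2 _ 2)// ?mulr_ge0//; apply/eqP.
by rewrite exprMn !sqr_hnorm !normrZ !exprMn mulrDr.
Qed.

Let hnorm0_eq0 x : hnorm x = 0 -> x = 0.
Proof.
move=> /(congr1 (fun z => z ^+ 2)); rewrite sqr_hnorm expr0n/= => /eqP.
rewrite paddr_eq0 ?exprn_ge0// !expf_eq0/= !normr_eq0.
by case: x => a b /= /andP[/eqP-> /eqP->].
Qed.

HB.instance Definition _ :=
  Lmodule_isNormed.Build K W hnormD hnormZ hnorm0_eq0.

Lemma sqr_norm_hsum (x : W) : `|x| ^+ 2 = `|x.1| ^+ 2 + `|x.2| ^+ 2.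
Proof. exact: sqr_hnorm. Qed.

Let norm_fst (x : W) : `|x.1| <= `|x|.
Proof.
by rewrite -(@ler_pXn2r _ 2)// ?nnegrE// sqr_norm_hsum lerDl exprn_ge0.
Qed.

Let norm_snd (x : W) : `|x.2| <= `|x|.
Proof.
by rewrite -(@ler_pXn2r _ 2)// ?nnegrE// sqr_norm_hsum lerDr exprn_ge0.
Qed.

Let norm_le (x : W) : `|x| <= `|x.1| + `|x.2|.
Proof.
rewrite -(@ler_pXn2r _ 2)// ?nnegrE ?addr_ge0// sqr_norm_hsum sqrrD.
by rewrite addrAC lerDl mulrn_wge0// mulr_ge0.
Qed.

Let hsum_complete (F : set_system W) : ProperFilter F -> cauchy F -> cvg F.
Proof.
move=> FF /cauchyP cF.
have c1 : cauchy ((fun x : W => x.1) @ F).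
  apply/cauchyP => e e0; have [x Fx] := cF _ e0; exists x.1.
  apply: (@filterS _ F _ _ _ _ Fx) => y; rewrite -!ball_normE/=; apply: le_lt_trans.
  exact: (norm_fst (x - y)).
have c2 : cauchy ((fun x : W => x.2) @ F).
  apply/cauchyP => e e0; have [x Fx] := cF _ e0; exists x.2.
  apply: (@filterS _ F _ _ _ _ Fx) => y; rewrite -!ball_normE/=; apply: le_lt_trans.
  exact: (norm_snd (x - y)).
have /cvg_ex[/= u /cvgrPdist_lt Fu] : cvg ((fun x : W => x.1) @ F).
  exact: cauchy_cvg c1.
have /cvg_ex[/= v /cvgrPdist_lt Fv] : cvg ((fun x : W => x.2) @ F).
  exact: cauchy_cvg c2.
apply/cvg_ex; exists ((u, v) : W); apply/cvgrPdist_lt => e e0; near=> x.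
apply: (le_lt_trans (norm_le _)); rewrite [ltRHS]splitr ltrD//=.
- by near: x; apply: Fu; rewrite divr_gt0.
- by near: x; apply: Fv; rewrite divr_gt0.
Unshelve. all: by end_near. Qed.

HB.instance Definition _ := Uniform_isComplete.Build W hsum_complete.

Definition hsum_inner (x y : W) : K := inner x.1 y.1 + inner x.2 y.2.

Let hsum_innerC x y : hsum_inner x y =
  (-1) ^+ false * scalar_conj R k (hsum_inner y x).
Proof.
rewrite expr0 mul1r /hsum_inner scalar_conjD.
by rewrite (hermitian_subproof x.1) (hermitian_subproof x.2) !expr0 !mul1r.
Qed.

Let hsum_inner_gt0 x : x != 0 -> 0 < hsum_inner x x.
Proof.
move=> x0; rewrite /hsum_inner -!sqr_norm_inner -sqr_norm_hsum.
by rewrite exprn_gt0// normr_gt0.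
Qed.

Let hsum_inner_zmodl y : zmod_morphism (hsum_inner ^~ y).
Proof.
move=> x z; rewrite /hsum_inner.
rewrite (zmod_morphisml_subproof y.1 x.1 z.1).
rewrite (zmod_morphisml_subproof y.2 x.2 z.2).
by rewrite opprD addrACA.
Qed.

Let hsum_inner_zmodr x : zmod_morphism (hsum_inner x).
Proof.
move=> y z; rewrite /hsum_inner.
rewrite (zmod_morphismr_subproof x.1 y.1 z.1).
rewrite (zmod_morphismr_subproof x.2 y.2 z.2).
by rewrite opprD addrACA.
Qed.

Let hsum_innerZl y : scalable_for *%R (hsum_inner ^~ y).
Proof.
move=> a x; rewrite /hsum_inner.
rewrite (linearl_subproof y.1 a x.1).
rewrite (linearl_subproof y.2 a x.2).
by rewrite mulrDr.
Qed.

Let hsum_innerZr x :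
  scalable_for (scalar_conj R k \; *%R) (hsum_inner x).
Proof.
move=> a y; rewrite /hsum_inner.
rewrite (linearr_subproof x.1 a y.1).
rewrite (linearr_subproof x.2 a y.2).
by rewrite /= mulrDr.
Qed.

HB.instance Definition _ := @isBilinear.Build K W W K *%R
  (scalar_conj R k \; *%R) hsum_inner
  hsum_inner_zmodl hsum_inner_zmodr hsum_innerZl hsum_innerZr.
HB.instance Definition _ := @isHermitianSesquilinear.Build K W false
  (scalar_conj R k) hsum_inner hsum_innerC.
HB.instance Definition _ := @isDotProduct.Build K W hsum_inner hsum_inner_gt0.

Let sqr_norm_hsum_inner (x : W) : `|x| ^+ 2 = hsum_inner x x.
Proof. by rewrite sqr_norm_hsum !sqr_norm_inner. Qed.

HB.instance Definition _ := CompleteNormedModule_isHilbert.Build R k W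
  (inner := hsum_inner) sqr_norm_hsum_inner.

Lemma hsum_innerE (x y : W) : inner x y = inner x.1 y.1 + inner x.2 y.2.
Proof. by []. Qed.

End HilbertSum.

Section LinearRelations.
Context {R : realType} {k : scalar_kind}.
Implicit Types X Y Z H K : hilbertType R k.

Definition relation X Y := set (hsum X Y).

Definition linear_relation X Y (A : relation X Y) : Prop :=
  GRing.submod_closed (mem A : {pred hsum X Y}).

Definition rel_graph X Y (f : X -> Y) : relation X Y :=
  [set (x, f x) | x in [set: X]].

Definition rel_adjoint X Y (A : relation X Y) : relation Y X :=
  [set yx | forall x y, A (x, y) -> inner x yx.2 = inner y yx.1].

Definition rel_inv X Y (A : relation X Y) : relation Y X := (A ^-1)%relation.

Definition rel_mul X Y Z (B : relation Y Z) (A : relation X Y) : relation X Z :=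
  (B \; A)%relation.

Definition operatorwise_sum X Y (A1 A2 : relation X Y) : relation X Y :=
  [set hk | exists k1 k2,
    [/\ A1 (hk.1, k1), A2 (hk.1, k2) & hk.2 = k1 + k2]].

Definition componentwise_sum X Y (A1 A2 : relation X Y) : relation X Y :=
  [set (x.1 + y.1, x.2 + y.2) | x in A1 & y in A2].

Definition rel_row H1 H2 K (R1 : relation H1 K) (R2 : relation H2 K) :
    relation (hsum H1 H2) K :=
  [set hk | exists k1 k2,
    [/\ R1 (hk.1.1, k1), R2 (hk.1.2, k2) & hk.2 = k1 + k2]].

End LinearRelations.

(* Main.v *)
Require Import Defs.
From mathcomp Require Import all_boot all_order all_algebra.
From mathcomp Require Import boolp classical_sets reals.

Set Implicit Arguments.
Unset Strict Implicit.
Unset Printing Implicit Defensive.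

Import GRing.Theory Num.Theory.
Local Open Scope classical_set_scope.
Local Open Scope ring_scope.

(** The adjoint of the coordinate projection [P_i] is the inclusion of the
    [i]-th summand, because the inner product of the Hilbert sum splits as the
    sum of the inner products of the coordinates. So [R_1 P~_1^-1] consists of
    the pairs [((h_1, 0), k_1)] with [(h_1, k_1)] in [R_1], and symmetrically
    for [R_2]; adding them componentwise reassembles
    [((h_1, h_2), k_1 + k_2)], which is the row. On the other side, [R_i P_i]
    applies [R_i] to the [i]-th coordinate of one common vector [(h_1, h_2)],
    and the operatorwise sum adds the values, which is the row again.

    The only analytic input is that an adjoint is determined by the inner
    products ([inner_injr]); it makes [P~_i] the graph of the inclusion and
    nothing more ([rel_adjoint_graph]). *)

Section HilbertSpace.
Context {R : realType} {k : scalar_kind}.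
Implicit Types X Y Z : hilbertType R k.

(** Testing against [u - v] itself gives [`|u - v| ^+ 2 = 0]. *)
Lemma inner_injr X (u v : X) :
  (forall x : X, inner x u = inner x v) -> u = v.
Proof.
move=> uv; apply/eqP; rewrite -subr_eq0 -normr_eq0 -sqrf_eq0 sqr_norm_inner.
by rewrite linearBr /= uv subrr.
Qed.

(** Passing to the formal adjoint [g] of [f] loses nothing since [f] is
    everywhere defined: all values of the adjoint relation at [y] have the
    same inner products with every vector, hence coincide with [g y]. *)
Lemma rel_adjoint_graph X Y (f : X -> Y) (g : Y -> X) :
  (forall x y, inner x (g y) = inner (f x) y) ->
  rel_adjoint (rel_graph f) = rel_graph g.
Proof.
move=> fg; apply/seteqP; split=> [[y x'] adj|_ [y _ <-] x _ [_ _ [<- <-]]//=].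
exists y => //; congr pair; apply: inner_injr => x.
by rewrite fg -(adj x (f x))//; exists x.
Qed.

Lemma rel_mul_graphE X Y Z (B : relation Y Z) (f : X -> Y) :
  rel_mul B (rel_graph f) = [set xz | B (f xz.1, xz.2)].
Proof.
apply/seteqP; split=> [[x z] [_ [_ _ [<- <-]]]//|[x z] Bfx].
by exists (f x) => //; exists x.
Qed.

Lemma rel_mul_inv_graphE X Y Z (B : relation Y Z) (g : Y -> X) x z :
  rel_mul B (rel_inv (rel_graph g)) (x, z) <-> exists2 y, g y = x & B (y, z).
Proof.
split=> [[_ [y _ [<- <-]] Byz]|[y <- Byz]]; first by exists y.
by exists y => //; exists y.
Qed.

End HilbertSpace.

Section HilbertSumInclusions.
Context {R : realType} {k : scalar_kind} {H1 H2 : hilbertType R k}.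

Definition hsum_inl (h : H1) : hsum H1 H2 := (h, 0).
Definition hsum_inr (h : H2) : hsum H1 H2 := (0, h).

Lemma rel_adjoint_fst :
  rel_adjoint (rel_graph (fun h : hsum H1 H2 => h.1)) = rel_graph hsum_inl.
Proof.
by apply: rel_adjoint_graph => x y; rewrite hsum_innerE /= linear0r addr0.
Qed.

Lemma rel_adjoint_snd :
  rel_adjoint (rel_graph (fun h : hsum H1 H2 => h.2)) = rel_graph hsum_inr.
Proof.
by apply: rel_adjoint_graph => x y; rewrite hsum_innerE /= linear0r add0r.
Qed.

End HilbertSumInclusions.

Section Row.
Context {R : realType} {k : scalar_kind} {H1 H2 K : hilbertType R k}.
Context (R1 : relation H1 K) (R2 : relation H2 K).

Lemma rel_row_componentwise :
  rel_row R1 R2 = componentwise_sum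
    (rel_mul R1 (rel_inv (rel_graph hsum_inl)))
    (rel_mul R2 (rel_inv (rel_graph hsum_inr))).
Proof.
apply/seteqP; split=> [[[h1 h2] x] [k1 [k2 [/= Rk1 Rk2 ->]]]|].
  exists (hsum_inl h1, k1); first by apply/rel_mul_inv_graphE; exists h1.
  exists (hsum_inr h2, k2); first by apply/rel_mul_inv_graphE; exists h2.
  by rewrite /= /hsum_inl /hsum_inr; congr ((_, _), _); rewrite ?addr0 ?add0r.
move=> _ [[_ k1] /rel_mul_inv_graphE[h1 <- Rk1]]
  [[_ k2] /rel_mul_inv_graphE[h2 <- Rk2] <-].
by exists k1, k2; split; rewrite //= ?addr0 ?add0r.
Qed.

Lemma rel_row_operatorwise :
  rel_row R1 R2 = operatorwise_sum
    (rel_mul R1 (rel_graph (fun h : hsum H1 H2 => h.1)))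
    (rel_mul R2 (rel_graph (fun h : hsum H1 H2 => h.2))).
Proof. by rewrite !rel_mul_graphE. Qed.

End Row.

Theorem lemma3p4 (R : realType) (k : scalar_kind) (H1 H2 K : hilbertType R k)
    (R1 : relation H1 K) (R2 : relation H2 K)
    (linR1 : linear_relation R1) (linR2 : linear_relation R2) :
  let P1 : relation (hsum H1 H2) H1 := rel_graph (fun h : hsum H1 H2 => h.1) in
  let P2 : relation (hsum H1 H2) H2 := rel_graph (fun h : hsum H1 H2 => h.2) in
  let P1t : relation H1 (hsum H1 H2) := rel_adjoint P1 in
  let P2t : relation H2 (hsum H1 H2) := rel_adjoint P2 in
  rel_row R1 R2 =
    componentwise_sum (rel_mul R1 (rel_inv P1t)) (rel_mul R2 (rel_inv P2t)) /\
  componentwise_sum (rel_mul R1 (rel_inv P1t)) (rel_mul R2 (rel_inv P2t)) =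
    operatorwise_sum (rel_mul R1 P1) (rel_mul R2 P2).
Proof.
move=> P1 P2 P1t P2t; rewrite /P1t /P2t rel_adjoint_fst rel_adjoint_snd.
by rewrite -rel_row_componentwise -rel_row_operatorwise.
Qed.
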